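(* Let $W \subset \mathbb{R}^h$ be an arbitrary subspace of dimension $\dim(W) = \delta h$, and let $E_s \in \mathbb{R}^{r_s h \times h}$, $s = 1,\dots,q$, be arbitrary matrices with $r_s \geq 1$. Let $0 < \kappa, \eta, \eta_1,\dots,\eta_q \le 1$ satisfy $\delta + \kappa + \eta + \sum_{s=1}^q \eta_s \leq 1$. Then there exists a matrix $U \in \mathbb{R}^{h \times h}$ satisfying all of the following: (i) $U_{jj} \le 1$ for all $j \in [h]$; (ii) $\mathsf{Tr}(U) \ge \kappa h$; (iii) $\langle w w^\top, U\rangle = 0$ for all $w \in W$; (iv) $U \preceq \frac{1}{\eta}\,\mathsf{diag}(U)$; (v) $E_s U E_s^\top \preceq \frac{r_s}{\eta_s}\,\mathsf{diag}(E_s U E_s^\top)$ for all $s \in [q]$; (vi) $U \succeq 0$.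
   Context: For a square matrix $M$, $\mathsf{diag}(M)$ denotes the diagonal matrix with the same diagonal entries as $M$. $\langle X, Y\rangle = \mathsf{Tr}(X^\top Y)$, and $\preceq$ is the Loewner (positive semidefinite) order. *)

(* Defs.v *)
From mathcomp Require Import all_boot all_order all_algebra.
From mathcomp Require Import reals.

Set Implicit Arguments.
Unset Strict Implicit.
Unset Printing Implicit Defensive.

Import Order.TTheory GRing.Theory Num.Theory.
Local Open Scope ring_scope.

Definition diagpart (R : realType) (n : nat) (M : 'M[R]_n) : 'M[R]_n :=
  diag_mx (\row_j M j j).

Definition mxinner (R : realType) (m n : nat) (X Y : 'M[R]_(m, n)) : R :=
  \tr (X^T *m Y).

(* Symmetry is part of the definition: over the reals it does not follow from
   the sign of the quadratic form. *)
Definition psdmx (R : realType) (n : nat) (M : 'M[R]_n) : Prop :=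
  M^T = M /\ forall x : 'cV[R]_n, 0 <= (x^T *m M *m x) 0 0.

Definition loewner_le (R : realType) (n : nat) (A B : 'M[R]_n) : Prop :=
  psdmx (B - A).

(* Main.v *)
(* By duality it suffices to treat one family of multipliers at a time: the
   feasible U with respect to (i), (ii), (iii), (vi) form a compact convex set,
   and a minimax argument reduces (iv) and (v) to finding, for each family of
   positive semidefinite matrices G_i, a point U of that set satisfying the
   single inequality
     0 <= sum_i <G_i, c_i diag(E_i U E_i^T) - E_i U E_i^T>
        = sum_i <c_i diag(G_i) - G_i, E_i U E_i^T>.
   For a positive semidefinite n x n matrix G, the form c diag(G) - G is
   nonnegative on a subspace of codimension at most n / c, because G rescaled
   to have unit diagonal has trace at most n.  Pulling these subspaces back
   along the E_i and intersecting them with the orthogonal complement of W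
   leaves dimension at least kappa h, and U can be taken to be the orthogonal
   projection onto the intersection. *)
Require Import Defs.
From HB Require Import structures.
From mathcomp Require Import all_boot all_order all_algebra.
From mathcomp Require Import reals.
From mathcomp Require Import finmap all_classical topology normedtype derive.
From mathcomp Require Import ring lra.

Set Implicit Arguments.
Unset Strict Implicit.

Import Order.TTheory GRing.Theory Num.Theory.
Import numFieldNormedType.Exports.
Local Open Scope classical_set_scope.
Local Open Scope ring_scope.

(** * Positive semidefinite forms and orthogonal projections *)

Lemma tr_diagpart (R : realType) n (M : 'M[R]_n) : (diagpart M)^T = diagpart M.
Proof. exact: tr_diag_mx. Qed.

Lemma dot_sum (R : realType) n (u v : 'cV[R]_n) : (u^T *m v) 0 0 = \sum_i u i 0 * v i 0.
Proof. by rewrite mxE; apply: eq_bigr => i _; rewrite mxE. Qed.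

Lemma psd_congr (R : realType) m n (M : 'M[R]_n) (B : 'M[R]_(m, n)) :
  psdmx M -> psdmx (B *m M *m B^T).
Proof.
move=> [symM posM]; split=> [|x]; first by rewrite !trmx_mul trmxK symM mulmxA.
by have := posM (B^T *m x); rewrite trmx_mul trmxK !mulmxA.
Qed.

Lemma dot_ge0 (R : realType) n (y : 'cV[R]_n) : 0 <= (y^T *m y) 0 0.
Proof. by rewrite dot_sum sumr_ge0 // => i _; rewrite -expr2 sqr_ge0. Qed.

Lemma dot_eq0 (R : realType) n (y : 'cV[R]_n) : (y^T *m y) 0 0 = 0 -> y = 0.
Proof.
rewrite dot_sum => /psumr_eq0P h; apply/matrixP => i j; rewrite ord1 mxE.
have /eqP := h (fun i _ => sqr_ge0 (y i 0)) i isT.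
by rewrite mulf_eq0 orbb => /eqP.
Qed.

Lemma psd_proj (R : realType) n (P : 'M[R]_n) : P^T = P -> P *m P = P -> psdmx P.
Proof.
move=> symP idP; split=> // x.
have -> : x^T *m P *m x = (P *m x)^T *m (P *m x).
  by rewrite trmx_mul symP mulmxA -(mulmxA _ P P) idP.
exact: dot_ge0.
Qed.

(** The diagonal entry of a symmetric idempotent is the squared norm of its row, hence at least its
    own square. *)
Lemma proj_diag_le1 (R : realType) n (P : 'M[R]_n) j :
  P^T = P -> P *m P = P -> P j j <= 1.
Proof.
move=> symP idP.
have h : P j j ^+ 2 <= P j j.
  rewrite -[in leRHS]idP mxE (bigD1 j) //= expr2 lerDl sumr_ge0 // => i _.
  by rewrite -[X in P X i]/j -{1}symP mxE -expr2 sqr_ge0.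
nra.
Qed.

(** The form is tested on vectors supported on two coordinates; choices of [a] and [b] then give the
    sign of the diagonal, the vanishing of rows and the bound on entries. *)
Lemma psd_quad2 (R : realType) n (M : 'M[R]_n) i j (a b : R) : psdmx M ->
  0 <= a ^+ 2 * M i i + 2 * a * b * M i j + b ^+ 2 * M j j.
Proof.
move=> [symM /(_ (a *: delta_mx i 0 + b *: delta_mx j 0))].
have E (k l : 'I_n) :
    ((delta_mx k 0 : 'cV[R]_n)^T *m M *m (delta_mx l 0 : 'cV[R]_n)) 0 0 = M k l.
  by rewrite trmx_delta -rowE -colE !mxE.
have Mji : M j i = M i j by rewrite -[in LHS]symM mxE.
rewrite [_^T]linearD !linearZ /= !mulmxDl !mulmxDr -!scalemxAl -!scalemxAr.
have entryD (A B : 'M[R]_1) : (A + B) 0 0 = A 0 0 + B 0 0 by rewrite mxE.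
have entryZ c (A : 'M[R]_1) : (c *: A) 0 0 = c * A 0 0 by rewrite mxE.
rewrite !(entryD, entryZ) {entryD entryZ}.
rewrite !E Mji; congr (_ <= _); ring.
Qed.

Lemma psd_diag_ge0 (R : realType) n (M : 'M[R]_n) i : psdmx M -> 0 <= M i i.
Proof. by move=> /(psd_quad2 i i 1 0); lra. Qed.

Lemma psd_entry_eq0 (R : realType) n (M : 'M[R]_n) i j :
  psdmx M -> M i i = 0 -> M i j = 0.
Proof.
move=> psdM Mii; apply/eqP/negP => /negP Mij.
(* The coefficient makes the cross term equal to [- (M j j + 1)], so the whole form would be -1. *)
have := psd_quad2 i j (- (M j j + 1) / (2 * M i j)) 1 psdM.
rewrite Mii mulr0 add0r expr1n mul1r mulr1.
have -> : 2 * (- (M j j + 1) / (2 * M i j)) * M i j = - (M j j + 1) by field.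
lra.
Qed.

Lemma psd_entry_le1 (R : realType) n (M : 'M[R]_n) i j :
  psdmx M -> (forall k, M k k <= 1) -> `|M i j| <= 1.
Proof.
move=> psdM M1; have := M1 i; have := M1 j.
have := psd_quad2 i j 1 1 psdM; have := psd_quad2 i j 1 (-1) psdM.
rewrite ler_norml => *; apply/andP; split; nra.
Qed.

Lemma trace_congr (R : realType) m n (A : 'M[R]_n) (B : 'M[R]_(n, m)) :
  \tr (B^T *m A *m B) = \sum_j ((col j B)^T *m A *m col j B) 0 0.
Proof.
apply: eq_bigr => j _.
by rewrite tr_col -row_mul [RHS]mxE [LHS]mxE; apply: eq_bigr => k _; rewrite !mxE.
Qed.

(** * Subspaces of small codimension on which a form is controlled *)

(** Rows are treated one at a time: if [P] does not kill the new row [v], subtracting the rank-one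
    projection onto [P *m v^T] costs exactly one unit of trace. *)
Lemma kernel_proj (R : realType) h N (M : 'M[R]_(N, h)) :
  exists P : 'M[R]_h, [/\ P^T = P, P *m P = P, M *m P = 0 & h%:R <= \tr P + N%:R].
Proof.
elim: N M => [|N IH] M.
  exists 1%:M; split; rewrite ?trmx1 ?mul1mx ?mxtrace1 ?addr0 //.
  by apply/matrixP => -[].
pose v := usubmx (M : 'M_(1 + N, h)); pose M' := dsubmx (M : 'M_(1 + N, h)).
have mulM (X : 'M_h) : v *m X = 0 -> M' *m X = 0 -> M *m X = 0.
  have E : M *m X = col_mx v M' *m X :> 'M_(1 + N, h) by rewrite vsubmxK.
  by move=> vX M'X; rewrite [LHS]E mul_col_mx vX M'X col_mx0.
have [P [symP idP M'P trP]] := IH M'.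
pose z := P *m v^T; have zT : z^T = v *m P by rewrite trmx_mul trmxK symP.
have [z0|z_neq0] := eqVneq z 0.
  exists P; split=> //; last by rewrite (le_trans trP) // lerD2l ler_nat.
  by apply: mulM => //; rewrite -zT z0 trmx0.
pose d := (z^T *m z) 0 0; have d_neq0 : d != 0.
  by apply: contra z_neq0 => /eqP/dot_eq0 ->.
have zzd : z^T *m z = d%:M by rewrite [LHS]mx11_scalar.
have Pz : P *m z = z by rewrite mulmxA idP.
have zP : z^T *m P = z^T by rewrite zT -mulmxA idP.
exists (P - d^-1 *: (z *m z^T)); split.
- by rewrite linearB linearZ /= symP trmx_mul trmxK.
- have zzP : z *m z^T *m P = z *m z^T by rewrite -mulmxA zP.
  have zzzz : z *m z^T *m (z *m z^T) = d *: (z *m z^T).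
    by rewrite mulmxA -(mulmxA z) zzd mul_mx_scalar -scalemxAl.
  rewrite mulmxBl !mulmxBr -!scalemxAl -!scalemxAr idP mulmxA Pz zzP zzzz.
  by rewrite [_ *: (d *: _)]scalerA mulVf // scale1r subrr subr0.
- apply: mulM; rewrite mulmxBr -scalemxAr mulmxA.
    have -> : v *m z = d%:M by rewrite -zzd zT -mulmxA Pz.
    by rewrite mul_scalar_mx scalerA mulVf // scale1r zT subrr.
  by rewrite M'P [M' *m z]mulmxA M'P !mul0mx scaler0 subr0.
rewrite [\tr (_ - _)]raddfB /= mxtraceZ mxtrace_mulC zzd mxtrace_scalar mulr1n mulVf //.
by rewrite -addn1 natrD; lra.
Qed.

(* Deflation: if some y has y^T A y > c |y|^2, compressing A to the complement
   of y lowers the trace by more than c. *)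
Lemma psd_few_large_directions (R : realType) n (A : 'M[R]_n) (c : R) :
  0 < c -> psdmx A ->
  exists k, exists B : 'M[R]_(k, n), c * k%:R <= \tr A /\
    forall y : 'cV_n, B *m y = 0 -> (y^T *m A *m y) 0 0 <= c * (y^T *m y) 0 0.
Proof.
(* Induction on an integer [N] above [\tr A / c]: a deflation allows [N] to drop by one, and at
   [N = 0] the trace would be negative. *)
move=> c_gt0 psdA; have [N] : exists N : nat, \tr A < c * N%:R.
  exists (Num.bound (\tr A / c)); rewrite mulrC -ltr_pdivrMr //.
  apply: archi_boundP; apply: divr_ge0 (ltW c_gt0).
  exact: sumr_ge0 (fun i _ => psd_diag_ge0 i psdA).
elim: N A psdA => [|N IH] A psdA trA.
  have : 0 <= \tr A by exact: sumr_ge0 (fun i _ => psd_diag_ge0 i psdA).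
  by rewrite leNgt -(mulr0 c) trA.
have [smallA|] := pselect (forall y : 'cV_n, (y^T *m A *m y) 0 0 <= c * (y^T *m y) 0 0).
  exists 0, 0; split=> [|y _]; last exact: smallA.
  by rewrite mulr0; exact: sumr_ge0 (fun i _ => psd_diag_ge0 i psdA).
move=> /existsNP[y /negP]; rewrite -ltNge => largeA.
have d_gt0 : 0 < (y^T *m y) 0 0.
  rewrite lt_def dot_ge0 andbT; apply: contraTN largeA => /eqP/dot_eq0 ->.
  by rewrite !mulmx0 !mxE mulr0 ltxx.
pose d := (y^T *m y) 0 0; pose P := 1%:M - d^-1 *: (y *m y^T).
have symP : P^T = P by rewrite linearB linearZ /= trmx1 trmx_mul trmxK.
have Py : P *m y = 0.
  rewrite mulmxBl mul1mx -scalemxAl -mulmxA [y^T *m y]mx11_scalar mul_mx_scalar.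
  by rewrite scalerA mulVf ?scale1r ?subrr // gt_eqF.
have idP : P *m P = P.
  by rewrite {2}/P mulmxBr mulmx1 -scalemxAr mulmxA Py mul0mx scaler0 subr0.
have trPAP : \tr (P *m A *m P) = \tr A - (y^T *m A *m y) 0 0 / d.
  rewrite mxtrace_mulC mulmxA idP mulmxBl mul1mx -scalemxAl.
  rewrite [\tr (_ - _)]raddfB /= mxtraceZ.
  by rewrite [\tr (_ *m A)]mxtrace_mulC mulmxA mxtrace_mulC mulmxA trace_mx11 mulrC.
have lt_trPAP : \tr (P *m A *m P) < \tr A - c.
  by rewrite trPAP ltrD2l ltrN2 ltr_pdivlMr.
have := psd_congr P psdA; rewrite symP => psdPAP.
have [] := IH _ psdPAP.
  by rewrite (lt_trans lt_trPAP) // ltrBlDr -[X in _ + X]mulr1 -mulrDr natr1.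
(* The extra row [y^T] forces [P *m x = x], so the compressed form and [A] agree on the new
   kernel. *)
move=> k [B [ck smallPAP]]; exists (1 + k)%N, (col_mx y^T B).
split; first by rewrite natrD mulrDr mulr1; lra.
move=> x; rewrite mul_col_mx -[X in _ = X]col_mx0 => /eq_col_mx[yx Bx].
have Px : P *m x = x.
  by rewrite mulmxBl mul1mx -scalemxAl -mulmxA yx mulmx0 scaler0 subr0.
have xP : x^T *m P = x^T by rewrite -{2}Px trmx_mul symP.
by have := smallPAP x Bx; rewrite !mulmxA xP -!mulmxA Px.
Qed.

(* G = S A S with S = diag(sqrt G_jj) and A of trace at most n; indices with
   G_jj = 0 are harmless because the whole row of G vanishes there. *)
Lemma psd_diag_dominated (R : realType) n (G : 'M[R]_n) (c : R) :
  0 < c -> psdmx G ->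
  exists k, exists B : 'M[R]_(k, n), c * k%:R <= n%:R /\
    forall y : 'cV_n, B *m y = 0 ->
      0 <= (y^T *m (c *: diagpart G - G) *m y) 0 0.
Proof.
move=> c_gt0 psdG; pose s j := Num.sqrt (G j j).
pose S : 'M[R]_n := diag_mx (\row_j s j).
(* Since the inverse of 0 is 0, [T] vanishes at the indices where [G j j = 0]. *)
pose T : 'M[R]_n := diag_mx (\row_j (s j)^-1).
have Gjj_ge0 j := psd_diag_ge0 j psdG.
have tT : T^T = T by rewrite tr_diag_mx.
have tS : S^T = S by rewrite tr_diag_mx.
have AE i j : (T *m G *m T) i j = (s i)^-1 * G i j * (s j)^-1.
  by rewrite mul_mx_diag mul_diag_mx !mxE.
have sE j : s j ^+ 2 = G j j by rewrite sqr_sqrtr.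
have s0 j : s j = 0 -> G j j = 0 by move=> sj; rewrite -sE sj expr0n.
have := psd_congr T psdG; rewrite tT => psdA.
have trA : \tr (T *m G *m T) <= n%:R.
  rewrite -[X in _ <= X%:R]card_ord -sumr_const; apply: ler_sum => j _; rewrite AE.
  have [sj|sj] := eqVneq (s j) 0; first by rewrite sj invr0 mulr0 ler01.
  by rewrite -sE expr2 mulKf // divff.
have SAS : S *m (T *m G *m T) *m S = G.
  have SE (A : 'M_n) i j : (S *m A *m S) i j = s i * A i j * s j.
    by rewrite mul_mx_diag mul_diag_mx !mxE.
  apply/matrixP => i j; rewrite SE AE.
  have [si|si] := eqVneq (s i) 0.
    by rewrite si !mul0r (psd_entry_eq0 j psdG (s0 i si)).
  have [sj|sj] := eqVneq (s j) 0.
    have -> : G i j = 0 by rewrite -psdG.1 mxE (psd_entry_eq0 i psdG (s0 j sj)).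
    by rewrite mulr0 mul0r mulr0 mul0r.
  by field; rewrite si sj.
have SS : S *m S = diagpart G.
  apply/matrixP => i j; rewrite mul_diag_mx !mxE mulrnAr -expr2 sE.
  by case: eqP => // ->.
have [k [B [ck small]]] := psd_few_large_directions c_gt0 psdA.
(* With [A = T *m G *m T], the substitution of [S *m y] turns the form of [A] into that of [G] and
   the squared norm into that of [diagpart G]. *)
exists k, (B *m S); split=> [|y]; first exact: le_trans trA.
have entryBZ a (X Y : 'M[R]_1) : (a *: X - Y) 0 0 = a * X 0 0 - Y 0 0 by rewrite !mxE.
have -> : c *: diagpart G - G = c *: diagpart G - S *m (T *m G *m T) *m S.
  by rewrite SAS.
rewrite -mulmxA => /small; rewrite trmx_mul tS !mulmxA -(mulmxA _ S S) SS.
rewrite mulmxBr mulmxBl -scalemxAr -scalemxAl !mulmxA entryBZ.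
by rewrite subr_ge0.
Qed.

(** Idempotence gives [E *m P *m E^T = (E *m P) *m (E *m P)^T], so the trace is a sum of values of
    [Q] at columns of [E *m P], which are images of vectors fixed by [P]. *)
Lemma proj_trace_ge0 (R : realType) h m (P : 'M[R]_h) (E : 'M[R]_(m, h)) (Q : 'M[R]_m) :
  P^T = P -> P *m P = P ->
  (forall x : 'cV_h, P *m x = x -> 0 <= ((E *m x)^T *m Q *m (E *m x)) 0 0) ->
  0 <= \tr (Q *m (E *m P *m E^T)).
Proof.
move=> symP idP posQ.
have -> : \tr (Q *m (E *m P *m E^T)) = \tr ((E *m P)^T *m Q *m (E *m P)).
  have -> : E *m P *m E^T = E *m P *m (E *m P)^T.
    by rewrite trmx_mul symP !mulmxA -(mulmxA E P P) idP.
  by move: (E *m P) => F; rewrite mulmxA mxtrace_mulC mulmxA.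
rewrite trace_congr; apply: sumr_ge0 => j _.
have -> : col j (E *m P) = E *m (P *m delta_mx j 0) by rewrite colE mulmxA.
by apply: posQ; rewrite mulmxA idP.
Qed.

Lemma trace_diagpartC (R : realType) n (X Y : 'M[R]_n) :
  \tr (X *m diagpart Y) = \tr (diagpart X *m Y).
Proof.
apply: eq_bigr => i _; rewrite mul_mx_diag mul_diag_mx !mxE; exact: erefl.
Qed.

(* The negative part a |-> min(a,0)^2 is the squared distance to the half-line
   of nonnegative reals, whence the first-order upper bound. *)
Lemma sqr_minr0_le (R : realType) (a d : R) :
  Num.min (a + d) 0 ^+ 2 <= Num.min a 0 ^+ 2 + 2 * Num.min a 0 * d + d ^+ 2.
Proof. by rewrite !minEle; case: (leP (a + d) 0) => ?; case: (leP a 0) => ?; nra. Qed.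

(** * Topology of matrix spaces and a theorem of the alternative on compact sets *)

Lemma mx_continuous (R : realType) m n (T : topologicalType) (f : T -> 'M[R]_(m, n)) :
  (forall i j, continuous (fun x => f x i j)) -> continuous f.
Proof.
move=> cf x A [P nP PA].
have : \forall y \near x, forall i j, P i j (f y i j).
  apply: filter_forall => i; apply: filter_forall => j; exact: (cf i j x _ (nP i j)).
by apply: filterS => y; exact: PA.
Qed.

Lemma sum_continuous (R : realType) (T : topologicalType) (I : Type) (s : seq I)
    (f : I -> T -> R) :
  (forall i, continuous (f i)) -> continuous (fun x => \sum_(i <- s) f i x).
Proof.
by move=> cf x; apply: cvg_big => [|i _]; [exact: add_continuous | exact: cf].
Qed.

Lemma scalar_continuous (R : realType) m n (f : 'M[R]_(m, n) -> R) :
  scalar f -> continuous f.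
Proof.
move=> lf; pose g : {scalar 'M[R]_(m, n)} :=
  HB.pack f (GRing.isLinear.Build _ _ _ _ f lf).
have -> : f = fun M => \sum_i \sum_j M i j * g (delta_mx i j).
  apply/funext => M; rewrite -[f]/(g : _ -> _) {1}[M]matrix_sum_delta linear_sum.
  by apply: eq_bigr => i _; rewrite linear_sum; apply: eq_bigr => j _; rewrite linearZ.
apply: sum_continuous => i; apply: sum_continuous => j M.
have cM : M i j @[M --> M] --> M i j := @coord_continuous R m n i j M.
exact: (cvgMr_tmp cM).
Qed.

Lemma mx_box_compact (R : realType) m n (a b : R) :
  compact [set M : 'M[R]_(m, n) | forall i j, a <= M i j <= b].
Proof.
have cbox : compact [set v : 'rV[R]_(m * n) | forall k, `[a, b]%classic (v ord0 k)].
  apply: (@rV_compact R (m * n)%N (fun=> `[a, b]%classic)) => k.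
  exact: segment_compact.
have cvec : continuous (@vec_mx R m n).
  apply: mx_continuous => i j.
  have -> : (fun v : 'rV[R]_(m * n) => vec_mx v i j) =
      fun v => v ord0 (mxvec_index i j).
    by apply/funext => v; rewrite mxE.
  exact: coord_continuous.
have := continuous_compact (continuous_subspaceT cvec) cbox.
congr compact; apply/seteqP; split=> [_ [v vab <-] i j|M Mab].
  by rewrite mxE; have := vab (mxvec_index i j); rewrite /= in_itv.
exists (mxvec M); last by rewrite mxvecK.
by move=> k; case/mxvec_indexP: k => i j; rewrite mxvecE /= in_itv /=; exact: Mab.
Qed.

(* At a minimiser x of sum_i min(l i x, 0)^2, the first-order condition tested
   with the weights - min(l i x, 0) forces the minimum to be 0. *)
Lemma convexlike_finite (R : realType) (T : topologicalType) (K : set T)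
    (I : eqType) (l : I -> T -> R) (s : seq I) :
  compact K -> K !=set0 ->
  (forall i, continuous (l i)) ->
  (forall x y t, K x -> K y -> 0 <= t <= 1 ->
    exists2 z, K z & forall i, l i z = l i x + t * (l i y - l i x)) ->
  (forall a : I -> R, (forall i, 0 <= a i) ->
    exists2 x, K x & 0 <= \sum_(i <- s) a i * l i x) ->
  exists2 x, K x & forall i, i \in s -> 0 <= l i x.
Proof.
move=> cK K0 cl convK posK.
pose neg i x := Num.min (l i x) 0.
pose F x := \sum_(i <- s) neg i x ^+ 2.
have cF : continuous F.
  apply: sum_continuous => i x.
  have cneg : neg i y @[y --> x] --> neg i x.
    exact: (continuous2_cvg _ (@min_continuous _ R (l i x, 0)) (cl i x) (cvg_cst _)).
  exact: (cvgM cneg cneg).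
have [x xK Fx_min] := compact_EVT_min K0 cK (continuous_subspaceT cF).
rewrite inE in xK; exists x => //.
have weight_ge0 i : 0 <= - neg i x by rewrite oppr_ge0 ge_min lexx orbT.
have [y Ky posy] := posK _ weight_ge0.
pose B := \sum_(i <- s) neg i x * (l i y - l i x).
pose C := \sum_(i <- s) (l i y - l i x) ^+ 2.
(* [B] is half the first-order coefficient of the upper bound for [F] on the way from [x] to [y],
   and [C] the second-order one. *)
have F_le t : 0 <= t <= 1 -> 0 <= 2 * t * B + t ^+ 2 * C.
  move=> t01; have [z Kz lz] := convK x y t xK Ky t01.
  have := Fx_min z; rewrite inE => /(_ Kz) /le_trans.
  move=> /(_ (F x + (2 * t * B + t ^+ 2 * C))).
  rewrite lerDl; apply; rewrite /F !mulr_sumr -!big_split /=; apply: ler_sum => i _.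
  by rewrite /neg lz (le_trans (sqr_minr0_le _ _)) // exprMn; lra.
have C_ge0 : 0 <= C by apply: sumr_ge0 => i _; rewrite sqr_ge0.
have B_ge0 : 0 <= B.
  rewrite leNgt; apply/negP => B_lt0.
  have D_gt0 : 0 < C - B by lra.
  (* The denominator [C - B] stays positive even if [C = 0], keeps the step at most 1, and turns the
     increment into [t * (1 + t) * B], which is negative. *)
  have t01 : 0 <= - B / (C - B) <= 1.
    by rewrite divr_ge0 ?ler_pdivrMr //=; lra.
  have t_gt0 : 0 < - B / (C - B) by rewrite divr_gt0 //; lra.
  have := F_le _ t01; move: t_gt0; set t := - B / (C - B) => t_gt0.
  have tC : t * C = t * B - B.
    have : t * (C - B) = - B by rewrite /t divfK // gt_eqF.
    by rewrite mulrBr; lra.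
  have -> : 2 * t * B + t ^+ 2 * C = (t * (1 + t)) * B.
    have -> : t ^+ 2 * C = t * (t * C) by ring.
    by rewrite tC; ring.
  by rewrite pmulr_rge0 ?leNgt ?B_lt0 // mulr_gt0 // addr_gt0.
have negF : F x <= 0.
  (* Each squared negative part equals [neg i x * l i x], the term that also occurs in [B]. *)
  have -> : F x = - \sum_(i <- s) - neg i x * l i y - B.
    rewrite /F /B -sumrN -sumrB; apply: eq_bigr => i _; rewrite /neg.
    by rewrite minEle; case: (leP (l i x) 0) => ?; ring.
  by lra.
move=> i si; have neg_le0 : neg i x ^+ 2 <= 0.
  apply: le_trans negF; rewrite /F (big_rem i) //= lerDl.
  by apply: sumr_ge0 => k _; rewrite sqr_ge0.
have /eqP <- : neg i x == 0 by rewrite -sqrf_eq0 eq_le sqr_ge0 neg_le0.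
by rewrite ge_min lexx.
Qed.

(** The finite intersection property passes from finitely many functionals to all. The index [None]
    contributes [K] itself, which keeps the common point in [K] even when [I] is empty. *)
Lemma convexlike_alternative (R : realType) (T : ptopologicalType) (K : set T)
    (I : choiceType) (l : I -> T -> R) :
  compact K ->
  (forall i, continuous (l i)) ->
  (forall x y t, K x -> K y -> 0 <= t <= 1 ->
    exists2 z, K z & forall i, l i z = l i x + t * (l i y - l i x)) ->
  (forall (s : seq I) (a : I -> R), (forall i, 0 <= a i) ->
    exists2 x, K x & 0 <= \sum_(i <- s) a i * l i x) ->
  exists2 x, K x & forall i, 0 <= l i x.
Proof.
move=> cK cl convK posK.
have K0 : K !=set0 by have [x Kx _] := posK [::] (fun=> 0) (fun=> lexx 0); exists x.
have fam : closed_fam_of K [set: option I]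
    (fun o => if o is Some i then K `&` [set x | 0 <= l i x] else K `&` setT).
  exists (fun o => if o is Some i then [set x | 0 <= l i x] else setT); last by case.
  case=> [i|] _; last exact: closedT.
  have -> : [set x | 0 <= l i x] = l i @^-1` [set r | 0 <= r] by [].
  by apply: preimage_closed; [move=> ? _; exact: cl | exact: closed_ge].
move: (cK); rewrite compact_In0 => /(_ _ _ _ fam)[].
  move=> D' _.
  have [x Kx lx] := convexlike_finite (s := pmap id D') cK K0 cl convK (posK _).
  exists x => -[i /= iD|_]; last by split.
  by split=> //; apply: lx; rewrite mem_pmap; apply/mapP; exists (Some i).
move=> x lx; exists x; first by have [] := lx None Logic.I.
by move=> i; have [] := lx (Some i) Logic.I.
Qed.

(** * Defects and the projection attached to one family of multipliers *)

Lemma psd0 (R : realType) n : psdmx (0 : 'M[R]_n).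
Proof. by split=> [|x]; rewrite ?trmx0 // mulmx0 mul0mx mxE. Qed.

Lemma psd_lincomb (R : realType) n (A B : 'M[R]_n) (a b : R) :
  0 <= a -> 0 <= b -> psdmx A -> psdmx B -> psdmx (a *: A + b *: B).
Proof.
move=> a0 b0 [symA posA] [symB posB]; split=> [|x].
  by rewrite linearD !linearZ /= symA symB.
have entryZD (X Y : 'M[R]_1) : (a *: X + b *: Y) 0 0 = a * X 0 0 + b * Y 0 0.
  by rewrite !mxE.
rewrite mulmxDr mulmxDl -!scalemxAr -!scalemxAl entryZD.
by rewrite addr_ge0 ?mulr_ge0.
Qed.

Lemma psd_outer (R : realType) n (x : 'cV[R]_n) : psdmx (x *m x^T).
Proof.
by have := psd_congr x (psd_proj (trmx1 R 1) (mul1mx _)); rewrite mulmx1.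
Qed.

Definition defect (R : realType) m h (c : R) (E : 'M[R]_(m, h))
    (U : 'M[R]_h) : 'M[R]_m :=
  c *: diagpart (E *m U *m E^T) - E *m U *m E^T.

Lemma defect_linear (R : realType) m h (c : R) (E : 'M[R]_(m, h)) : linear (defect c E).
Proof.
move=> a U V; rewrite /defect mulmxDr mulmxDl -scalemxAr -scalemxAl.
move: (E *m U *m _) (E *m V *m _) => X Y.
by apply/matrixP => i j; rewrite !mxE; case: (i == j); rewrite /= ?mulr1n ?mulr0n; ring.
Qed.

Lemma defect_sym (R : realType) m h (c : R) (E : 'M[R]_(m, h)) U :
  U^T = U -> (defect c E U)^T = defect c E U.
Proof.
by move=> symU; rewrite linearB linearZ /= tr_diagpart !trmx_mul trmxK symU mulmxA.
Qed.

(** Taking the diagonal part is self-adjoint for the trace pairing, so the defect moves from [U] to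
    the multiplier. *)
Lemma trace_defectC (R : realType) m h (c : R) (E : 'M[R]_(m, h)) U (G : 'M[R]_m) :
  \tr (G *m defect c E U) = \tr ((c *: diagpart G - G) *m (E *m U *m E^T)).
Proof.
rewrite /defect; move: (E *m U *m E^T) => X.
rewrite mulmxBr mulmxBl -scalemxAr -scalemxAl ![\tr (_ - _)]raddfB /= !mxtraceZ.
by rewrite trace_diagpartC.
Qed.

Lemma common_projection (R : realType) h (I : finType) (n : I -> nat)
    (E : forall i, 'M[R]_(n i, h)) (c : I -> R) (G : forall i, 'M[R]_(n i))
    (W : {vspace 'cV[R]_h}) :
  (forall i, 0 < c i) -> (forall i, psdmx (G i)) ->
  exists P : 'M[R]_h, [/\ P^T = P, P *m P = P, forall w, w \in W -> P *m w = 0,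
    h%:R <= \tr P + ((\dim W)%:R + \sum_i (n i)%:R / c i) &
    forall i, 0 <= \tr (G i *m defect (c i) (E i) P)].
Proof.
move=> c_gt0 psdG.
(* The rows of [M] are a basis of [W] followed, for each [i], by at most [n i / c i] rows pulled
   back along [E i]. *)
have [N [M [leN MQ]]] : exists N, exists M : 'M[R]_(N, h),
    N%:R <= (\dim W)%:R + \sum_i (n i)%:R / c i /\
    (forall x : 'cV_h, M *m x = 0 ->
      (forall w, w \in W -> w^T *m x = 0) /\
      forall i, i \in index_enum I ->
        0 <= ((E i *m x)^T *m (c i *: diagpart (G i) - G i) *m (E i *m x)) 0 0).
  elim: (index_enum I) => [|i s [N [M [leN MQ]]]].
    exists (\dim W), (\matrix_(k < \dim W) ((vbasis W)`_k)^T).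
    rewrite big_nil addr0; split=> // x Mx; split=> // w wW.
    rewrite (coord_vbasis wW) linear_sum mulmx_suml big1 // => k _.
    rewrite linearZ /= -scalemxAl.
    have := congr1 (row k) Mx; rewrite row_mul rowK row0 => ->.
    by rewrite scaler0.
  have [k [B [ck small]]] := psd_diag_dominated (c_gt0 i) (psdG i).
  exists (k + N)%N, (col_mx (B *m E i) M); split.
    rewrite big_cons natrD addrCA lerD // ler_pdivlMr //.
    by rewrite mulrC.
  move=> x; rewrite mul_col_mx -[X in _ = X]col_mx0 => /eq_col_mx[Bx /MQ[Wx Qx]].
  split=> // j; rewrite inE => /predU1P[->|/Qx //].
  by apply: small; rewrite mulmxA.
have [P [symP idP MP trP]] := kernel_proj M.
have MP0 (x : 'cV_h) : M *m (P *m x) = 0 by rewrite mulmxA MP mul0mx.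
exists P; split=> //.
(* The squared norm of [P *m w] is the product of [w^T] with [P *m w], a vector of the kernel of
   [M], hence orthogonal to [W]. *)
- move=> w wW; apply: dot_eq0; have [/(_ w wW) wPw _] := MQ _ (MP0 w).
  by rewrite trmx_mul symP -mulmxA [P *m _]mulmxA idP wPw mxE.
- by apply: le_trans trP _; rewrite lerD2l.
move=> i; rewrite trace_defectC; apply: proj_trace_ge0 => // x Px.
have [|_] := MQ x; first by rewrite -Px MP0.
by apply; rewrite mem_index_enum.
Qed.

(** * Compactness and convexity of the base set, and the minimax argument *)

Lemma closed_scalar_ge (R : realType) m n (f : 'M[R]_(m, n) -> R) (a : R) :
  scalar f -> closed [set M | a <= f M].
Proof.
move=> lf; have -> : [set M | a <= f M] = f @^-1` [set r | a <= r] by [].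
by apply: preimage_closed; [move=> ? _; exact: scalar_continuous | exact: closed_ge].
Qed.

Lemma quad_scalar (R : realType) n (x : 'cV[R]_n) :
  scalar (fun M : 'M[R]_n => (x^T *m M *m x) 0 0).
Proof.
move=> a U V; rewrite mulmxDr mulmxDl -scalemxAr -scalemxAl.
by move: (_ *m U *m _) (_ *m V *m _) => X Y; rewrite !mxE.
Qed.

Lemma closed_psd (R : realType) n : closed [set M : 'M[R]_n | psdmx M].
Proof.
(* Symmetry is an inequality for every ordered pair of indices, so only closed half-spaces occur. *)
have -> : [set M : 'M[R]_n | psdmx M] =
    \bigcap_(ij in [set: 'I_n * 'I_n])
      [set M : 'M[R]_n | 0 <= M ij.1 ij.2 - M ij.2 ij.1] `&`
    \bigcap_(x in [set: 'cV[R]_n]) [set M : 'M[R]_n | 0 <= (x^T *m M *m x) 0 0].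
  apply/seteqP; split=> M /= [symM posM]; split.
  - by move=> [i j] _ /=; rewrite -{1}symM mxE subrr.
  - by move=> x _; exact: posM.
  - apply/matrixP => i j; rewrite mxE.
    have := symM (i, j) Logic.I; have := symM (j, i) Logic.I; rewrite /=; lra.
  - by move=> x; exact: (posM x Logic.I).
apply: closedI; apply: closed_bigI => x _; apply: closed_scalar_ge.
  by move=> a U V; rewrite !mxE; ring.
exact: quad_scalar.
Qed.

Lemma psd_sum (R : realType) n (J : Type) (s : seq J) (a : J -> R) (G : J -> 'M[R]_n) :
  (forall j, 0 <= a j) -> (forall j, psdmx (G j)) -> psdmx (\sum_(j <- s) a j *: G j).
Proof.
move=> a0 psdG; elim: s => [|j s IH]; first by rewrite big_nil; exact: psd0.
by rewrite big_cons -[X in _ + X]scale1r; exact: psd_lincomb.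
Qed.

Lemma mxinner_outer (R : realType) n (w : 'cV[R]_n) (U : 'M[R]_n) :
  mxinner (w *m w^T) U = (w^T *m U *m w) 0 0.
Proof.
by rewrite /mxinner trmx_mul trmxK mxtrace_mulC mulmxA mxtrace_mulC mulmxA trace_mx11.
Qed.

(* The spectral constraints (iv) and (v) are left out of [base_feasible]; they are
   all of the form [defect] >= 0. *)
Section Feasibility.
Variables (R : realType) (h : nat) (I : finType) (n : I -> nat).
Variables (E : forall i, 'M[R]_(n i, h)) (c : I -> R) (W : {vspace 'cV[R]_h}) (t : R).

Definition base_feasible : set 'M[R]_h :=
  [set U | [/\ psdmx U, forall w, w \in W -> (w^T *m U *m w) 0 0 = 0,
             forall j, U j j <= 1 & t <= \tr U]].

Lemma base_feasible_compact : compact base_feasible.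
Proof.
apply: (subclosed_compact _ (@mx_box_compact R h h (-1) 1)); last first.
  by move=> U [psdU _ U1 _] i j; rewrite -ler_norml psd_entry_le1.
(* One inequality suffices for the vanishing on [W]; the opposite one comes from positive
   semidefiniteness. *)
have -> : base_feasible = [set U | psdmx U] `&`
    (\bigcap_(w in [set w : 'cV[R]_h | w \in W])
       [set U : 'M[R]_h | 0 <= - (w^T *m U *m w) 0 0] `&`
    (\bigcap_(j in [set: 'I_h]) [set U : 'M[R]_h | -1 <= - U j j] `&`
     [set U : 'M[R]_h | t <= \tr U])).
  apply/seteqP; split=> [U [psdU WU U1 trU]|U [psdU [WU [U1 trU]]]].
    split=> //; split=> [w wW|] /=; first by rewrite WU // oppr0.
    by split=> // j _; rewrite /= lerN2.
  split=> // [w wW|j]; last by rewrite -lerN2; exact: U1.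
  by apply/eqP; rewrite eq_le -oppr_ge0 (WU w wW) (psdU.2 w).
apply: closedI; first exact: closed_psd.
apply: closedI; last apply: closedI.
- apply: closed_bigI => w _; apply: closed_scalar_ge => a U V.
  by rewrite quad_scalar; ring.
- by apply: closed_bigI => j _; apply: closed_scalar_ge => a U V; rewrite !mxE; ring.
- by apply: closed_scalar_ge => a U V; rewrite mxtraceD mxtraceZ.
Qed.

Lemma base_feasible_convex U V (a : R) :
  base_feasible U -> base_feasible V -> 0 <= a <= 1 ->
  base_feasible (a *: (V - U) + U).
Proof.
move=> [psdU WU U1 trU] [psdV WV V1 trV] /andP[a0 a1].
split.
- have -> : a *: (V - U) + U = a *: V + (1 - a) *: U.
    by rewrite scalerBr scalerBl scale1r addrAC addrA.
  by apply: psd_lincomb; rewrite ?subr_ge0.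
- by move=> w wW; rewrite [V - U]addrC -scaleN1r !quad_scalar WU // WV //; ring.
- by move=> j; have := U1 j; have := V1 j; rewrite !mxE; nra.
rewrite mxtraceD mxtraceZ [\tr (V - U)]raddfB /=; nra.
Qed.

Hypothesis c_gt0 : forall i, 0 < c i.
Hypothesis dims : (\dim W)%:R + \sum_i (n i)%:R / c i + t <= h%:R.

Lemma feasible_exists :
  exists2 U, base_feasible U & forall i, psdmx (defect (c i) (E i) U).
Proof.
(* The functionals are indexed by all families of positive semidefinite multipliers; [{classic J}]
   equips them with a choice structure. *)
pose J := {G : forall i, 'M[R]_(n i) | forall i, psdmx (G i)}.
pose l (j : {classic J}) U := \sum_i \tr (sval j i *m defect (c i) (E i) U).
have lin_l j : scalar (l j).
  move=> a U V; rewrite /l mulr_sumr -big_split /=; apply: eq_bigr => i _.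
  by rewrite defect_linear mulmxDr -scalemxAr mxtraceD mxtraceZ.
have [|j|U V a KU KV a01|s a a_ge0|U KU lU] :=
    @convexlike_alternative R _ base_feasible {classic J} l.
- exact: base_feasible_compact.
- exact: scalar_continuous.
- exists (a *: (V - U) + U); first exact: base_feasible_convex.
  move=> j; rewrite lin_l addrC; congr (_ + _ * _).
  by rewrite [V - U]addrC -scaleN1r lin_l mulN1r addrC.
(* A nonnegative combination of families is again such a family, so a single projection handles
   it. *)
- pose G i := \sum_(j <- s) a j *: (sval j : forall i, 'M[R]_(n i)) i.
  have psdG i : psdmx (G i) by apply: psd_sum => // j; exact: (svalP j i).
  have [P [symP idP WP trP posP]] := common_projection E W c_gt0 psdG.
  exists P.
    split; first exact: psd_proj.
    - by move=> w wW; rewrite -mulmxA WP // mulmx0 mxE.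
    - by move=> j; exact: proj_diag_le1.
    - by move: dims trP; lra.
  have -> : \sum_(j <- s) a j * l j P = \sum_i \tr (G i *m defect (c i) (E i) P).
    under eq_bigr do rewrite mulr_sumr; rewrite exchange_big /=.
    apply: eq_bigr => i _; rewrite mulmx_suml raddf_sum /=.
    by apply: eq_bigr => j _; rewrite -scalemxAl mxtraceZ.
  exact: sumr_ge0.
exists U => // i; split; first by apply: defect_sym; case: KU => -[].
(* The multiplier [x *m x^T] placed at [i] alone recovers the quadratic form of the defect at
   [x]. *)
move=> x; pose G := eqtype.dfwith (fun k => 0 : 'M[R]_(n k)) (x *m x^T).
have psdG k : psdmx (G k).
  by rewrite /G; case: eqtype.dfwithP => [|k' _]; [exact: psd_outer | exact: psd0].
have := lU (exist _ G psdG); rewrite /l (bigD1 i) //= big1 ?addr0.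
  by rewrite /G dfwith_in -mulmxA mxtrace_mulC trace_mx11.
by move=> k ki; rewrite /G dfwith_out 1?eq_sym // mul0mx mxtrace0.
Qed.

End Feasibility.

(** * Specialisation to the constraints (iv) and (v) *)

Lemma sum_option (R : realType) (I : finType) (F : option I -> R) :
  \sum_o F o = F None + \sum_i F (Some i).
Proof.
rewrite (bigD1 None) //=; congr (_ + _).
rewrite (reindex_omap Some id) => [|[i|] //]; apply: eq_bigl => i.
by rewrite eqxx.
Qed.

Theorem theorem2p2 (R : realType) (h q : nat) (W : {vspace 'cV[R]_h}) (delta : R)
    (r : 'I_q -> R) (m : 'I_q -> nat) (E : forall s : 'I_q, 'M[R]_(m s, h))
    (kappa eta : R) (etas : 'I_q -> R) :
  (\dim W)%:R = delta * h%:R ->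
  (forall s, 1 <= r s) ->
  (forall s, (m s)%:R = r s * h%:R) ->
  0 < kappa <= 1 ->
  0 < eta <= 1 ->
  (forall s, 0 < etas s <= 1) ->
  delta + kappa + eta + \sum_(s < q) etas s <= 1 ->
  exists U : 'M[R]_h,
    [/\ [/\ (forall j, U j j <= 1),
            kappa * h%:R <= \tr U &
            (forall w, w \in W -> mxinner (w *m w^T) U = 0)],
        loewner_le U (eta^-1 *: diagpart U),
        (forall s, loewner_le (E s *m U *m (E s)^T)
                     ((r s / etas s) *: diagpart (E s *m U *m (E s)^T))) &
        psdmx U].
Proof.
move=> dimW r_ge1 mE _ /andP[eta_gt0 _] etas01 budget.
have etas_gt0 s : 0 < etas s by case/andP: (etas01 s).
have r_gt0 s : 0 < r s by rewrite (lt_le_trans ltr01).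
(* [None] stands for constraint (iv): the identity matrix with factor 1 / eta. *)
pose n (o : option 'I_q) := if o is Some s then m s else h.
pose F (o : option 'I_q) : 'M[R]_(n o, h) :=
  match o with Some s => E s | None => 1%:M end.
pose c (o : option 'I_q) := if o is Some s then r s / etas s else eta^-1.
have c_gt0 o : 0 < c o by case: o => [s|] /=; rewrite ?divr_gt0 ?invr_gt0.
(* The dimension costs [n o / c o] are [eta * h] for (iv) and [etas s * h] for (v), so this is the
   budget inequality multiplied by [h]. *)
have dims : (\dim W)%:R + \sum_o (n o)%:R / c o + kappa * h%:R <= h%:R.
  rewrite sum_option /= invrK dimW.
  have -> : \sum_(s < q) (m s)%:R / (r s / etas s) = (\sum_(s < q) etas s) * h%:R.
    rewrite mulr_suml; apply: eq_bigr => s _; rewrite mE.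
    by field; rewrite !gt_eqF.
  have := ler_wpM2r (ler0n R h) budget; lra.
have [U [psdU WU U1 trU] psdF] := feasible_exists F c_gt0 dims.
exists U; split=> //; first by split=> // w wW; rewrite mxinner_outer WU.
- by have := psdF None; rewrite /defect /= trmx1 mul1mx mulmx1.
- by move=> s; exact: (psdF (Some s)).
Qed.
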